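(* Let $n,k,\ell$ be positive integers, and let $\Gamma=\mathrm{Cay}(\mathbb{Z}_n,\{x^k,x^{-k},x^\ell,x^{-\ell}\})$ be a connected circulant quartic graph. Then: (i) If $k\equiv1\pmod 3$ and $\ell\equiv1\pmod 3$, then $\Gamma$ contains a $(0,2)$-regular set if and only if $n$ is a multiple of $3$. (ii) If $k\equiv1\pmod 3$ and $\ell\equiv0\pmod 3$, or $\ell\equiv1\pmod 3$ and $k\equiv0\pmod 3$, then $\Gamma$ contains no $(0,2)$-regular set.
   Context: $\mathbb{Z}_n=\langle x\rangle$ denotes the cyclic group of order $n$, written multiplicatively. For a finite group $G$ with identity $e$ and an inverse-closed subset $S\subseteq G\setminus\{e\}$, the Cayley graph $\mathrm{Cay}(G,S)$ is the simple graph with vertex set $G$ in which $y$ and $z$ are adjacent if and only if $y^{-1}z\in S$. A circulant quartic graph is a graph $\mathrm{Cay}(\mathbb{Z}_n,\{x^k,x^{-k},x^\ell,x^{-\ell}\})$ where $x^k,x^{-k},x^\ell,x^{-\ell}$ are four distinct non-identity elements. For a graph $\Gamma$ and nonnegative integers $a,b$, a nonempty proper subset $C$ of $V(\Gamma)$ is an $(a,b)$-regular set of $\Gamma$ if every vertex in $C$ has exactly $a$ neighbours in $C$ and every vertex in $V(\Gamma)\setminus C$ has exactly $b$ neighbours in $C$. *)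

(* Defs.v *)
From mathcomp Require Import all_boot all_order all_fingroup.

Set Implicit Arguments.
Unset Strict Implicit.
Unset Printing Implicit Defensive.

(* A simple graph is given by its adjacency relation on a                     *)
(* finite type; [Cay S] is symmetric and irreflexive as soon as S is          *)
(* inverse-closed and does not contain 1.                                     *)

Definition Cay (gT : finGroupType) (S : {set gT}) : rel gT :=
  fun y z => (y^-1 * z)%g \in S.

Definition graph_connected (T : finType) (e : rel T) : Prop :=
  forall y z : T, connect e y z.

Definition regular_set (T : finType) (e : rel T) (a b : nat) (C : {set T}) :
    Prop :=
  [/\ C != set0, C \proper [set: T],
      forall v, v \in C -> #|[set w in C | e v w]| = a &
      forall v, v \notin C -> #|[set w in C | e v w]| = b].

Definition circulant_set (gT : finGroupType) (x : gT) (k l : nat) : {set gT} :=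
  [set x ^+ k; x ^- k; x ^+ l; x ^- l]%g.

Definition quartic_condition (gT : finGroupType) (x : gT) (k l : nat) : Prop :=
  uniq [:: x ^+ k; x ^- k; x ^+ l; x ^- l]%g /\ 1%g \notin circulant_set x k l.

(* Main.v *)
Require Import Defs.
From mathcomp Require Import all_boot all_order all_fingroup.
From mathcomp Require Import all_algebra all_solvable all_field.
From mathcomp Require Import ring.

(** Why the theorem holds.  Let [C] be a [(0,2)]-regular set of
[Cay(Z_n, S)], with [S] the circulant connection set, and let [phi] be a
multiplicative function on the group.  Summing [phi] over the edges that end
in [C], in two ways, gives ([regular_set_transform])
      (phi(S) + 2) * phi(C) = 2 * phi(Z_n),
where [phi(A)] is the sum of [phi] over [A] (recall that [S] is closed under
inverses).

For [phi = 1] this says [3 * |C| = n], so [3] divides [n]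
([card_circulant_regular_set]); this is one direction of (i).  Conversely, if
[3] divides [n] then exponents of [x] make sense modulo [3], and when
[k = l = 1] modulo [3] the powers of [x ^ 3] form a regular set, because an
exponent that is [2] (resp. [1]) modulo [3] becomes [0] exactly after adding
(resp. subtracting) [k] or [l] ([mul3_regular_set]).

For (ii) suppose that [3] divides [l] but not [k], and let [q] be the largest
power of [3] dividing [n].  A [q]-th root of unity [z != 1] defines a
character of [Z_n], whose total sum is [0], so that
      (z^k + z^-k + z^l + z^-l + 2) * (sum of z^i over the x^i in C) = 0.
The first factor does not vanish ([circulant_eigenvalue_neq0]).  Hence all the
nontrivial characters of [Z_n] of order dividing [q] vanish on [C], which
means that [C] is equidistributed modulo [q]; so [q] divides [|C| = n / 3]
([dvdn_card_of_vanishing_chars]), and [3 * q] divides [n], contrary to the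
choice of [q]. *)

Set Implicit Arguments.
Unset Strict Implicit.
Unset Printing Implicit Defensive.

Import GroupScope GRing.Theory Num.Theory.

(** * Exponents in a cyclic group *)

Definition cyclic_log (gT : finGroupType) (x g : gT) : nat :=
  find (fun i => x ^+ i == g) (iota 0 #[x]).

Section CyclicLog.

Variables (gT : finGroupType) (x : gT).
Hypothesis gen_x : <[x]> = [set: gT].

Lemma cyclic_logK (g : gT) : x ^+ cyclic_log x g = g.
Proof.
have /cyclePmin[i lti ->] : g \in <[x]> by rewrite gen_x inE.
have hasx : has (fun j => x ^+ j == x ^+ i) (iota 0 #[x]).
  by apply/hasP; exists i; rewrite ?mem_iota ?eqxx.
have := nth_find 0 hasx; rewrite nth_iota ?add0n; first by move/eqP.
by move: hasx; rewrite has_find size_iota.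
Qed.

Lemma cyclic_logX i : cyclic_log x (x ^+ i) = i %[mod #[x]].
Proof. by apply/eqP; rewrite -eq_expg_mod_order cyclic_logK. Qed.

Lemma cyclic_logM g h :
  cyclic_log x (g * h) = cyclic_log x g + cyclic_log x h %[mod #[x]].
Proof. by apply/eqP; rewrite -eq_expg_mod_order expgD !cyclic_logK. Qed.

End CyclicLog.

(** * Sums over the connection set *)

Lemma sum_circulant_set (gT : finGroupType) (x : gT) (k l : nat)
    (R : nmodType) (F : gT -> R) :
  quartic_condition x k l ->
  (\sum_(s in circulant_set x k l) F s
     = F (x ^+ k)%g + F (x ^- k)%g + F (x ^+ l)%g + F (x ^- l)%g)%R.
Proof.
case=> uniq_s _.
rewrite (eq_bigl (mem [:: x ^+ k; x ^- k; x ^+ l; x ^- l])); last first.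
  by move=> s; rewrite !inE /= !orbA.
by rewrite -big_uniq //= !big_cons big_nil addr0 !addrA.
Qed.

Lemma card_Cay_neighbours (gT : finGroupType) (S C : {set gT}) (v : gT) :
  #|[set w in C | Cay S v w]| = \sum_(s in S) ((v * s)%g \in C).
Proof.
rewrite -sum1_card (reindex_inj (mulgI v)) /= big_mkcond [RHS]big_mkcond /=.
apply: eq_bigr => s _.
by rewrite inE /Cay mulKg andbC; case: (s \in S); case: (_ \in C).
Qed.

(** * Character sums over a regular set *)

Section Characters.

Local Open Scope ring_scope.

(** Both sides evaluate the sum of [phi v] over the pairs [(v, w)] with [w] in
[C] adjacent to [v].  Grouped by [v] it is known by regularity; grouped by
[(w, s)] with [v = w * s^-1] it factors, as [phi] is multiplicative. *)
Lemma regular_set_transform (gT : finGroupType) (S C : {set gT}) (a b : nat)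
    (R : comNzRingType) (phi : gT -> R) :
    {morph phi : g h / (g * h)%g >-> g * h} ->
    regular_set (Cay S) a b C ->
  (\sum_(s in S) phi s^-1%g + b%:R - a%:R) * (\sum_(v in C) phi v)
    = b%:R * \sum_v phi v.
Proof.
move=> phiM [_ _ nbC nbnC].
have count : \sum_v phi v * (#|[set w in C | Cay S v w]|)%:R
    = (\sum_(s in S) phi s^-1%g) * \sum_(v in C) phi v.
  rewrite big_distrl /=; under eq_bigr => v _ do
    rewrite card_Cay_neighbours natr_sum big_distrr /=.
  rewrite exchange_big; apply: eq_bigr => s _ /=.
  rewrite big_distrr (reindex_inj (mulIg s^-1%g)) /= [RHS]big_mkcond /=.
  by apply: eq_bigr => w _; rewrite mulgKV phiM mulr_natr mulrb mulrC.
have split_count : \sum_v phi v * (#|[set w in C | Cay S v w]|)%:R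
    = a%:R * (\sum_(v in C) phi v) + b%:R * (\sum_(v | v \notin C) phi v).
  rewrite (bigID (mem C)) /= !big_distrr /=.
  congr (_ + _); apply: eq_bigr => v vC.
    by rewrite nbC // mulrC.
  by rewrite nbnC // mulrC.
rewrite [\sum_v phi v](bigID (mem C)) /= mulrBl mulrDl -count split_count.
ring.
Qed.

(** Since [z ^+ #[x] = 1], the power [z ^+ i] depends only on [x ^+ i], which
makes [x ^+ i |-> z ^+ i] a linear character. *)
Section CyclicCharacter.

Variables (gT : finGroupType) (x : gT) (F : fieldType) (z : F).
Hypotheses (gen_x : <[x]>%g = [set: gT]) (zx : z ^+ #[x]%g = 1).

Definition cyclic_char (g : gT) : F := z ^+ cyclic_log x g.

Lemma cyclic_charM : {morph cyclic_char : g h / (g * h)%g >-> g * h}.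
Proof.
move=> g h; rewrite /cyclic_char -exprD -(expr_mod _ zx) cyclic_logM //.
by rewrite (expr_mod _ zx).
Qed.

Lemma cyclic_charX i : cyclic_char (x ^+ i)%g = z ^+ i.
Proof. by rewrite /cyclic_char -(expr_mod _ zx) cyclic_logX // expr_mod. Qed.

Lemma cyclic_charV g : cyclic_char g^-1%g = (cyclic_char g)^-1.
Proof.
have c1 : cyclic_char 1 = 1 by rewrite -[1%g](expg0 x) cyclic_charX.
have gV : cyclic_char g^-1%g * cyclic_char g = 1.
  by rewrite -cyclic_charM mulVg.
have g0 : cyclic_char g != 0.
  by apply: contra_eq_neq gV => ->; rewrite mulr0 eq_sym oner_neq0.
by apply: (mulIf g0); rewrite gV mulVf.
Qed.

(** Translation by [x] permutes the group and multiplies the sum by [z]. *)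
Lemma sum_cyclic_char : z != 1 -> \sum_g cyclic_char g = 0.
Proof.
move=> z1; apply/eqP; rewrite -(mulrI_eq0 _ (mulfI _ : GRing.lreg (1 - z))).
  rewrite mulrBl mul1r subr_eq0 eq_sym big_distrr /=; apply/eqP.
  rewrite [RHS](reindex_inj (mulgI x)); apply: eq_bigr => g _ /=.
  by rewrite cyclic_charM -[x in RHS]expg1 cyclic_charX.
by rewrite subr_eq0 eq_sym.
Qed.

End CyclicCharacter.

(** * Nonvanishing of the eigenvalue at roots of unity of 3-power order *)

Lemma sum_cube_root_unity (w : algC) (k : nat) :
  3.-primitive_root w -> ~~ (3 %| k)%N -> 1 + w ^+ k + w ^+ k ^+ 2 = 0.
Proof.
move=> prim_w k3; have wk1 : w ^+ k - 1 != 0.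
  by rewrite subr_eq0 -(prim_order_dvd prim_w).
apply: (mulfI wk1); rewrite mulr0.
have -> : (w ^+ k - 1) * (1 + w ^+ k + w ^+ k ^+ 2) = w ^+ k ^+ 3 - 1 by ring.
by rewrite exprAC (prim_expr_order prim_w) expr1n subrr.
Qed.

(** Let [z] have order [3 ^ s.+1].  If [s = 0] then [z ^+ l = 1] and
[z ^+ k + z ^- k = -1], so the value is [3].  If [s > 0] and the value is zero,
so are its conjugates under [z |-> z * w ^+ i], where [w = z ^+ (3 ^ s)] has
order [3] and [i = 0, 1, 2]: these are Galois conjugations because [z] and
[z * w ^+ i] have the same order, which fails for [s = 0].  They fix [z ^+ l]
as [3 %| l], while the conjugates of [z ^+ k] add up to [0].  The sum of the
three conjugates is thus [3 * (z ^+ l + z ^- l + 2)], and it vanishes only if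
[z ^+ l = -1], which is impossible since [z] has odd order. *)
Lemma circulant_eigenvalue_neq0 (k l r : nat) (z : algC) :
    ~~ (3 %| k)%N -> (3 %| l)%N -> z ^+ (3 ^ r) = 1 -> z != 1 ->
  z ^+ k + z ^- k + z ^+ l + z ^- l + 2%:R != 0.
Proof.
move=> k3 l3 zr z1.
have [m prim_z dvd_m] := prim_order_exists (expn_gt0 3 r : (0 < 3 ^ r)%N) zr.
have /(dvdn_pfactor _ _ (isT : prime 3))[s _ def_m] := dvd_m.
rewrite {}def_m {dvd_m m} in prim_z.
case: s prim_z => [|s] prim_z.
  by case/eqP: z1; have := prim_expr_order prim_z; rewrite expn0 expr1.
have zs := prim_expr_order prim_z.
have z0 : z != 0.
  apply: contra_eq_neq zs => ->.
  by rewrite expr0n expn_eq0 eq_sym oner_neq0.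
pose w := z ^+ (3 ^ s).
have prim_w : 3.-primitive_root w.
  have := dvdn_prim_root prim_z (dvdn_exp (isT : 0 < s.+1)%N (dvdnn 3)).
  by rewrite expnS mulKn.
have sum_wk := sum_cube_root_unity prim_w k3.
have wk0 : w ^+ k != 0 by rewrite !expf_neq0.
have zk0 : z ^+ k != 0 by rewrite expf_neq0.
have zl0 : z ^+ l != 0 by rewrite expf_neq0.
have sum_wVk : 1 + w ^- k + w ^- k ^+ 2 = 0.
  apply: (mulfI (expf_neq0 2 wk0)); rewrite mulr0 -sum_wk; field.
  exact: wk0.
have wl1 : w ^+ l = 1 by apply/eqP; rewrite -(prim_order_dvd prim_w).
apply/eqP => eig0.
case: s => [|s] in prim_z zs w prim_w sum_wk wk0 sum_wVk wl1 *.
  have zl1 : z ^+ l = 1 by rewrite -wl1 /w expr1.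
  have : (3%:R : algC) = 0.
    have szk : 1 + z ^+ k + z ^- k = 0.
      apply: (mulfI zk0); rewrite mulr0 -sum_wk /w expn0 expr1.
      by field; exact: zk0.
    have := congr2 (fun a b => a - b) eig0 szk; rewrite zl1 invr1 subr0 => <-.
    ring.
  by move/eqP; rewrite pnatr_eq0.
have conj_eig i :
    z ^+ k * w ^+ k ^+ i + z ^- k * w ^- k ^+ i + z ^+ l + z ^- l + 2%:R = 0.
  (* This exponent realizes z |-> z * w ^+ i, as w = z ^+ (3 ^ s.+1). *)
  have co : coprime (1 + i * 3 ^ s.+1) (3 ^ s.+2).
    rewrite coprimeXr // coprime_sym prime_coprime // addnC dvdn_addr //.
    by rewrite expnS mulnCA dvdn_mulr.
  have [u uE] := Qn_aut_exists co.
  have uz : u z = z * w ^+ i by rewrite uE // exprD expr1 mulnC exprM.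
  have := congr1 u eig0.
  rewrite !rmorphD !fmorphV !rmorphXn !rmorph0 !rmorph1 uz.
  by rewrite !exprMn !(exprAC w i) wl1 expr1n mulr1 invfM exprVn.
have : 3%:R * (z ^+ l + 1) ^+ 2 = 0.
  have <- : z ^+ l * (z ^+ k * (1 + w ^+ k + w ^+ k ^+ 2)
      + z ^- k * (1 + w ^- k + w ^- k ^+ 2)
      + 3%:R * (z ^+ l + z ^- l + 2%:R)) = 3%:R * (z ^+ l + 1) ^+ 2.
    by rewrite sum_wk sum_wVk !mulr0; field; exact: zl0.
  have E := congr2 (fun a b => a + b)
     (congr2 (fun a b => a + b) (conj_eig 0) (conj_eig 1)) (conj_eig 2).
  rewrite -[RHS](mulr0 (z ^+ l)); congr (_ * _).
  rewrite !addr0 in E; rewrite -E; ring.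
(* z ^+ l + z ^- l + 2 is a square up to the unit z ^+ l. *)
move/eqP; rewrite mulf_eq0 pnatr_eq0 /= sqrf_eq0 addr_eq0 => /eqP zlN1.
have : (-1 : algC) ^+ (3 ^ s.+2) = 1.
  by rewrite -zlN1 exprAC zs expr1n.
rewrite -signr_odd oddX expr1 => /eqP.
by rewrite eq_sym -subr_eq0 opprK -mulr2n pnatr_eq0.
Qed.

(** Fourier inversion at the identity of the quotient of order [q]: summing
the characters over all the [q]-th roots of unity leaves [#|C|] from the
trivial one, and gives [q] times the number of elements of [C] whose exponent
is divisible by [q]. *)
Lemma dvdn_card_of_vanishing_chars (gT : finGroupType) (x : gT) (q : nat)
    (C : {set gT}) :
    <[x]>%g = [set: gT] -> (q %| #[x]%g)%N ->
    (forall z : algC, z ^+ q = 1 -> z != 1 ->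
       \sum_(v in C) cyclic_char x z v = 0) ->
  (q %| #|C|)%N.
Proof.
move=> gen_x qx vanish.
have q_gt0 : (0 < q)%N := dvdn_gt0 (order_gt0 x) qx.
have [z prim_z] := C_prim_root_exists q_gt0.
have zq := prim_expr_order prim_z.
pose N := (\sum_(v in C) (q %| cyclic_log x v))%N.
suff /eqP : (#|C|%:R : algC) = (q * N)%:R.
  by rewrite eqr_nat => /eqP ->; apply: dvdn_mulr.
transitivity (\sum_(j < q) \sum_(v in C) cyclic_char x (z ^+ j) v).
  rewrite (bigD1 (Ordinal q_gt0)) //= [X in _ + X]big1 => [|j j0].
    by rewrite addr0 -sum1_card natr_sum; apply: eq_bigr => v _;
       rewrite /cyclic_char expr0 expr1n.
  apply: vanish; first by rewrite exprAC zq expr1n.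
  rewrite -(prim_order_dvd prim_z) gtnNdvd // lt0n.
  by apply: contra j0 => /eqP j0; apply/eqP/val_inj.
rewrite exchange_big natrM natr_sum big_distrr; apply: eq_bigr => v _ /=.
under eq_bigr do rewrite /cyclic_char exprAC.
have [dv | ndv] := boolP (q %| _)%N.
  have /eqP zv : z ^+ cyclic_log x v == 1 by rewrite -(prim_order_dvd prim_z).
  under eq_bigr do rewrite zv expr1n.
  by rewrite mulr1 sumr_const card_ord.
rewrite mulr0; have zv : z ^+ cyclic_log x v - 1 != 0.
  by rewrite subr_eq0 -(prim_order_dvd prim_z).
apply: (mulfI zv); rewrite mulr0 -subrX1.
by rewrite exprAC zq expr1n subrr.
Qed.

(** This is the transform at the trivial character: the count of the edges
between [C] and its complement reads [4 * #|C| = 2 * (#|gT| - #|C|)]. *)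
Lemma card_circulant_regular_set (gT : finGroupType) (x : gT) (k l : nat)
    (C : {set gT}) :
    quartic_condition x k l -> regular_set (Cay (circulant_set x k l)) 0 2 C ->
  (3 * #|C| = #|gT|)%N.
Proof.
move=> quartic regC.
have := regular_set_transform (phi := fun=> 1 : int) _ regC.
move=> /(_ (fun _ _ => esym (mulr1 1))).
rewrite (sum_circulant_set (fun=> 1 : int) quartic).
rewrite !sumr_const => E.
apply/eqP; rewrite -(eqr_nat int) natrM.
rewrite -(inj_eq (mulfI (_ : 2%:R != 0 :> int))) //.
by rewrite -[#|gT|]/#|predT| -E; apply/eqP; ring.
Qed.

End Characters.

(** * Existence and nonexistence of regular sets *)

(** With [q] the [3]-part of the order of the group, [q] divides [#|C|], and
[3 * #|C|] is that order: its [3]-part would be at least [3 * q]. *)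
Lemma no_circulant_regular_set (gT : finGroupType) (x : gT) (k l : nat)
    (C : {set gT}) :
    <[x]> = [set: gT] -> quartic_condition x k l ->
    ~~ (3 %| k) -> 3 %| l ->
  ~ regular_set (Cay (circulant_set x k l)) 0 2 C.
Proof.
move=> gen_x quartic k3 l3 regC.
have cardC := card_circulant_regular_set quartic regC.
have ox : #|gT| = #[x] by rewrite orderE gen_x cardsT.
have qC : 3 ^ logn 3 #[x] %| #|C|.
  apply: (dvdn_card_of_vanishing_chars gen_x (pfactor_dvdnn 3 _)) => z zq z1.
  have zx : (z ^+ #[x] = 1)%R.
    by have /dvdnP[m ->] := pfactor_dvdnn 3 #[x]; rewrite mulnC exprM zq expr1n.
  have := regular_set_transform (cyclic_charM gen_x zx) regC.
  rewrite (sum_circulant_set _ quartic) sum_cyclic_char // mulr0 subr0.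
  rewrite !invgK !(cyclic_charV gen_x zx) !(cyclic_charX gen_x zx).
  have -> : (z ^- k + z ^+ k + z ^- l + z ^+ l + 2%:R
    = z ^+ k + z ^- k + z ^+ l + z ^- l + 2%:R :> algC)%R by ring.
  have /negbTE eig0 := circulant_eigenvalue_neq0 k3 l3 zq z1.
  by move/eqP; rewrite mulf_eq0 eig0 => /eqP.
have : 3 ^ (logn 3 #[x]).+1 %| #[x] by rewrite -{2}ox -cardC expnS dvdn_pmul2l.
by rewrite pfactor_dvdn ?order_gt0 // ltnn.
Qed.

Lemma circulant_setC (gT : finGroupType) (x : gT) (k l : nat) :
  circulant_set x k l = circulant_set x l k.
Proof. by rewrite /circulant_set -setUA setUC setUA. Qed.

Lemma quartic_conditionC (gT : finGroupType) (x : gT) (k l : nat) :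
  quartic_condition x k l -> quartic_condition x l k.
Proof.
case=> uniq_s one_s; split; last by rewrite circulant_setC.
have := uniq_catC [:: x ^+ k; x ^- k] [:: x ^+ l; x ^- l].
by rewrite /= => <-.
Qed.

(** Of the residues [m + 1] and [m + 2] modulo [3], one is zero if [m] is not
and none otherwise; each of them is reached twice from [m], the first through
[k] and [l], the second through [- k] and [- l]. *)
Lemma mul3_regular_set (gT : finGroupType) (x : gT) (k l : nat) :
    <[x]> = [set: gT] -> quartic_condition x k l -> 3 %| #[x] ->
    k = 1 %[mod 3] -> l = 1 %[mod 3] ->
  regular_set (Cay (circulant_set x k l)) 0 2 [set g | 3 %| cyclic_log x g].
Proof.
move=> gen_x quartic x3 k1 l1.
have log_mod g h : cyclic_log x (g * h)
    = cyclic_log x g + cyclic_log x h %[mod 3].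
  by rewrite -[LHS](modn_dvdm _ x3) cyclic_logM // modn_dvdm.
have logX i : cyclic_log x (x ^+ i) = i %[mod 3].
  by rewrite -[LHS](modn_dvdm _ x3) cyclic_logX // modn_dvdm.
have logM1 v i : i = 1 %[mod 3] ->
    cyclic_log x (v * x ^+ i) = (cyclic_log x v).+1 %[mod 3].
  by move=> i1; rewrite log_mod -modnDmr logX i1 modnDmr addn1.
have logV1 v i : i = 1 %[mod 3] ->
    cyclic_log x (v * x ^- i) = (cyclic_log x v).+2 %[mod 3].
  move=> i1; apply/eqP; rewrite -(eqn_modDr 1) addn1 -(logM1 _ i) // mulgKV.
  by rewrite addn1 -(addn3 (cyclic_log x v)) modnDr.
have one_of_three m : ((3 %| m.+1) + (3 %| m.+2) = ~~ (3 %| m))%N.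
  rewrite /dvdn -(add1n m) -(add2n m) -(modnDmr 1 m) -(modnDmr 2 m).
  by case: (m %% 3)%N (ltn_pmod m (isT : 0 < 3)%N) => [|[|[|r]]].
have nb v : #|[set w in [set g | 3 %| cyclic_log x g]
      | Cay (circulant_set x k l) v w]| = (2 * ~~ (3 %| cyclic_log x v))%N.
  rewrite card_Cay_neighbours (sum_circulant_set _ quartic) !inE /dvdn.
  by rewrite !logM1 // !logV1 // -one_of_three mul2n -addnn addnA.
split=> [|||v].
- by apply/set0Pn; exists 1; rewrite inE /dvdn -[1](expg0 x) logX.
- rewrite properEneq subsetT andbT; apply/eqP => /setP/(_ x).
  by rewrite !inE /dvdn -[x in cyclic_log _ x]expg1 logX.
- by move=> v; rewrite inE nb => ->.
by rewrite inE nb => ->.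
Qed.

Local Close Scope group_scope.
Local Open Scope nat_scope.

Theorem theorem6p2p8 (gT : finGroupType) (x : gT) (n k l : nat)
    (n_gt0 : 0 < n) (k_gt0 : 0 < k) (l_gt0 : 0 < l)
    (gen_x : <[x]>%g = [set: gT]) (order_x : #[x]%g = n)
    (quartic : quartic_condition x k l)
    (connected : graph_connected (Cay (circulant_set x k l))) :
  (k = 1 %[mod 3] -> l = 1 %[mod 3] ->
     ((exists C : {set gT}, regular_set (Cay (circulant_set x k l)) 0 2 C)
        <-> 3 %| n))
  /\
  ((k = 1 %[mod 3] /\ l = 0 %[mod 3]) \/ (l = 1 %[mod 3] /\ k = 0 %[mod 3]) ->
     ~ exists C : {set gT}, regular_set (Cay (circulant_set x k l)) 0 2 C).
Proof.
split=> [k1 l1 | kl [C regC]].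
  split=> [[C regC] | n3].
    rewrite -order_x orderE gen_x cardsT.
    by rewrite -(card_circulant_regular_set quartic regC) dvdn_mulr.
  exists [set g | 3 %| cyclic_log x g].
  by apply: mul3_regular_set => //; rewrite order_x.
case: kl => [[k1 l0] | [l1 k0]].
  apply: (no_circulant_regular_set (C := C) gen_x quartic) => //.
    by rewrite /dvdn k1.
  by rewrite /dvdn l0.
apply: (no_circulant_regular_set (C := C) gen_x (quartic_conditionC quartic)).
- by rewrite /dvdn l1.
- by rewrite /dvdn k0.
by rewrite circulant_setC.
Qed.
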